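(* Let $k\le n$ and $s$ be positive integers, let $\lambda$ be a partition of $k$ with at most $s$ parts, and let $\alpha_1,\dots,\alpha_s\in\mathbb{Q}$ be distinct. Then $R_{n,\lambda,s}\cong\mathbb{Q}X_{n,\lambda,s}$ as $S_n$-modules.
   Context: A partition $\lambda=(\lambda_1\ge\dots\ge\lambda_{\ell(\lambda)}>0)$ has length $\ell(\lambda)$; set $\lambda_i=0$ for $i>\ell(\lambda)$, and let $\lambda'_j=\#\{i:\lambda_i\ge j\}$ be the parts of the conjugate partition (with $\lambda'_j=0$ for large $j$). Let $\mathbf{x}_n=\{x_1,\dots,x_n\}$; $S_n$ acts on $\mathbb{Q}[\mathbf{x}_n]$ by permuting variables. For $S\subseteq\mathbf{x}_n$ and $d\ge1$, $e_d(S)$ is the sum of all squarefree monomials of degree $d$ in the variables in $S$ (so $e_d(S)=0$ if $d>|S|$). For $0\le m\le n$ let $p^n_m(\lambda)=\lambda'_n+\lambda'_{n-1}+\dots+\lambda'_{n-m+1}$. Define $$I_{n,\lambda,s}=\langle x_i^s : 1\le i\le n\rangle+\langle e_d(S): S\subseteq\mathbf{x}_n,\ d>|S|-p^n_{|S|}(\lambda)\rangle,\qquad R_{n,\lambda,s}=\mathbb{Q}[\mathbf{x}_n]/I_{n,\lambda,s}.$$ The ideal is $S_n$-stable, so $R_{n,\lambda,s}$ is an $S_n$-module. $X_{n,\lambda,s}$ is the set of points $p=(p_1,\dots,p_n)\in\mathbb{Q}^n$ such that every coordinate $p_i$ lies in $\{\alpha_1,\dots,\alpha_s\}$ and, for each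 $1\le i\le s$, $\alpha_i$ appears at least $\lambda_i$ times among the coordinates of $p$. $S_n$ acts on $X_{n,\lambda,s}$ by permuting coordinates, and $\mathbb{Q}X_{n,\lambda,s}$ is the corresponding permutation module of formal $\mathbb{Q}$-linear combinations of points of $X_{n,\lambda,s}$. *)

(* Defs.v *)
From HB Require Import structures.
From mathcomp Require Import all_boot all_fingroup all_algebra.
From mathcomp Require Import boolp.
From mathcomp Require Import freeg mpoly.

Set Implicit Arguments.
Unset Strict Implicit.
Unset Printing Implicit Defensive.

Import generic_quotient GRing.Theory.
Local Open Scope ring_scope.

(* action.v proves these two only for actions on a finType. *)
Section TotalActionTheory.
Context (gT : finGroupType) (X : Type) (to : {action gT &-> X}).

Lemma tactM x g h : to x (g * h)%g = to (to x g) h.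
Proof. by case: to => act [_ actM] /=; rewrite actM ?inE. Qed.

Lemma tact1 x : to x 1%g = x.
Proof.
have inj : left_injective to by case: to => ? [].
by apply: (inj 1%g); rewrite -tactM mulg1.
Qed.

End TotalActionTheory.

Section LinearActions.
Context (F : fieldType) (gT : finGroupType).

(* Library actions are right actions. On {perm T}, where (s * t) x = t (s x),
   a right action is the same thing as a left action of the group of
   permutations with the usual composition (s o t) x = s (t x). *)
Record linear_action (V : lmodType F) := LinearAction {
  lact :> {action gT &-> V};
  lact_linear : forall g : gT, linear (lact^~ g) }.

Definition module_iso (V W : lmodType F)
    (aV : linear_action V) (aW : linear_action W) : Prop :=
  exists f : {linear V -> W},
    bijective f /\ forall (v : V) (g : gT), f (aV v g) = aW (f v) g.

End LinearActions.

Section PermutationModule.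
Context (F : fieldType) (gT : finGroupType) (X : choiceType).
Variable to : {action gT &-> X}.

Definition perm_module_act (D : {freeg X / F}) (g : gT) : {freeg X / F} :=
  fglift (fun x => << to x g >> : {freeg X / F}) D.

Lemma perm_module_act_coeff D g x :
  coeff x (perm_module_act D g) = coeff (to x g^-1%g) D.
Proof.
rewrite -[in LHS](Freeg_enum D) -[in RHS](Freeg_enum D).
rewrite /perm_module_act fglift_Freeg coeff_Freeg /prelift /precoeff.
rewrite raddf_sum [RHS]big_mkcond /=; apply: eq_bigr => i _.
rewrite coeffZ coeffU mul1r.
have -> : (to i.2 g == x) = (i.2 == to x g^-1%g).
  by apply/eqP/eqP => [<-|->]; rewrite -tactM ?mulgV ?mulVg tact1.
by case: eqP => _; rewrite ?mulr1 ?mulr0.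
Qed.

Lemma perm_module_act_is_action : is_action [set: gT] perm_module_act.
Proof.
apply: is_total_action => [D|D g h]; apply/eqP/freeg_eqP => x.
  by rewrite perm_module_act_coeff invg1 tact1.
by rewrite !perm_module_act_coeff invMg tactM.
Qed.

Lemma perm_module_act_linear g : linear (perm_module_act^~ g).
Proof.
move=> a D1 D2; apply/eqP/freeg_eqP => x.
by rewrite coeffD coeffZ !perm_module_act_coeff coeffD coeffZ.
Qed.

Definition perm_module : linear_action gT {freeg X / F} :=
  @LinearAction F gT {freeg X / F}
    (Action perm_module_act_is_action) perm_module_act_linear.

End PermutationModule.

Section GeneratedIdeal.
Context (F : fieldType) (A : comAlgType F).
Variable G : A -> Prop.

Definition in_ideal (f : A) : Prop :=
  exists2 c : seq (A * A), (forall u, u \in c -> G u.2)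
                         & f = \sum_(u <- c) u.1 * u.2.

(* Boolean, through classical logic, as {ideal_quot _} requires. *)
Definition ideal_gen : {pred A} := fun f => `[< in_ideal f >].

Lemma ideal_genP f : reflect (in_ideal f) (f \in ideal_gen).
Proof. exact: asboolP. Qed.

Lemma ideal_genM a f : f \in ideal_gen -> a * f \in ideal_gen.
Proof.
move=> /ideal_genP[c Gc ->]; apply/ideal_genP.
exists [seq (a * u.1, u.2) | u <- c] => [_ /mapP[u /Gc Gu ->] //|].
by rewrite big_map mulr_sumr; apply: eq_bigr => u _; rewrite mulrA.
Qed.

Lemma ideal_gen_zmod : zmod_closed ideal_gen.
Proof.
split=> [|f g If Ig].
  by apply/ideal_genP; exists [::]; rewrite ?big_nil.
have /ideal_genP[d Gd Ed] := ideal_genM (-1) Ig.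
move/ideal_genP: If => [c Gc Ec]; apply/ideal_genP; exists (c ++ d).
  by move=> u; rewrite mem_cat => /orP[/Gc|/Gd].
by rewrite big_cat -Ec -Ed mulN1r.
Qed.

HB.instance Definition _ := GRing.isZmodClosed.Build A ideal_gen ideal_gen_zmod.

Local Notation Q := {ideal_quot ideal_gen}.

Lemma ideal_genZ a f : f \in ideal_gen -> a *: f \in ideal_gen.
Proof. by rewrite -mulr_algl; apply: ideal_genM. Qed.

Definition quot_scale (a : F) (x : Q) : Q := (\pi_Q (a *: repr x))%qT.

Lemma quot_scaleE a f : quot_scale a (\pi_Q f)%qT = (\pi_Q (a *: f))%qT.
Proof.
apply/eqP; rewrite -Quotient.idealrBE -scalerBr ideal_genZ //.
by rewrite Quotient.idealrBE reprK.
Qed.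

Fact quot_scaleA a b x : quot_scale a (quot_scale b x) = quot_scale (a * b) x.
Proof. by elim/quotW: x => f; rewrite (quot_scaleE b) !quot_scaleE scalerA. Qed.

Fact quot_scale1 : left_id 1 quot_scale.
Proof. by elim/quotW=> f; rewrite quot_scaleE scale1r. Qed.

Fact quot_scaleDr : right_distributive quot_scale +%R.
Proof.
move=> a; elim/quotW=> f; elim/quotW=> g.
by rewrite -raddfD !quot_scaleE scalerDr raddfD.
Qed.

Fact quot_scaleDl x : {morph quot_scale^~ x : a b / a + b}.
Proof. by elim/quotW: x => f a b; rewrite !quot_scaleE scalerDl raddfD. Qed.

HB.instance Definition _ :=
  GRing.Zmodule_isLmodule.Build F Q quot_scaleA quot_scale1 quot_scaleDr quot_scaleDl.

Lemma quot_pi_scale a f : (\pi_Q (a *: f) = a *: \pi_Q f)%qT.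
Proof. by rewrite -quot_scaleE. Qed.

Section QuotientAction.
Context (gT : finGroupType) (aA : linear_action gT A).
Hypothesis aA_stable : forall f g, f \in ideal_gen -> aA f g \in ideal_gen.

Definition quot_act (x : Q) (g : gT) : Q := (\pi_Q (aA (repr x) g))%qT.

Lemma quot_actE f g : quot_act (\pi_Q f)%qT g = (\pi_Q (aA f g))%qT.
Proof.
apply/eqP; rewrite -Quotient.idealrBE.
have -> : aA (repr (\pi_Q f)%qT) g - aA f g = aA (repr (\pi_Q f)%qT - f) g.
  have lin := lact_linear aA g.
  by rewrite -scaleN1r addrC -lin scaleN1r addrC.
by rewrite aA_stable // Quotient.idealrBE reprK.
Qed.

Lemma quot_act_is_action : is_action [set: gT] quot_act.
Proof.
apply: is_total_action => [|x g h]; first by elim/quotW=> f; rewrite quot_actE tact1.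
by elim/quotW: x => f; rewrite (quot_actE _ g) !quot_actE tactM.
Qed.

Lemma quot_act_linear g : linear (quot_act^~ g).
Proof.
move=> a; elim/quotW=> f; elim/quotW=> h.
by rewrite -quot_pi_scale -raddfD !quot_actE lact_linear raddfD /= quot_pi_scale.
Qed.

Definition quot_module : linear_action gT Q :=
  LinearAction (V := Q) (lact := Action quot_act_is_action) quot_act_linear.

End QuotientAction.
End GeneratedIdeal.

Section PolynomialModule.
Variable n : nat.

(* msym s is the Q-algebra automorphism sending 'X_i to 'X_(s i) *)
Definition mpoly_act (f : {mpoly rat[n]}) (s : 'S_n) : {mpoly rat[n]} := msym s f.

Lemma mpoly_act_is_action : is_action [set: 'S_n] mpoly_act.
Proof.
by apply: is_total_action => [f|f s t]; [apply: msym1m | apply: msymMm].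
Qed.

Lemma mpoly_act_linear s : linear (mpoly_act^~ s).
Proof. by move=> a f g; rewrite /mpoly_act linearP. Qed.

Definition mpoly_module : linear_action 'S_n {mpoly rat[n]} :=
  LinearAction (V := {mpoly rat[n]})
    (lact := Action mpoly_act_is_action) mpoly_act_linear.

Definition elem_sym (S : {set 'I_n}) (d : nat) : {mpoly rat[n]} :=
  \sum_(h : {set 'I_n} | (h \subset S) && (#|h| == d)) \prod_(i in h) 'X_i.

Lemma msymXi (s : 'S_n) (i : 'I_n) : msym s ('X_i : {mpoly rat[n]}) = 'X_(s i).
Proof.
rewrite msymX; congr 'X_[_]; apply/mnmP => j; rewrite !mnmE.
by congr nat_of_bool; apply/eqP/eqP => [->|<-]; rewrite ?permKV ?permK.
Qed.

Lemma msym_elem_sym (s : 'S_n) S d : msym s (elem_sym S d) = elem_sym [set s i | i in S] d.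
Proof.
have sI : injective s by apply: perm_inj.
have imK : cancel (fun h : {set 'I_n} => s @: h) (fun h => s @^-1: h).
  by move=> h; apply/setP => i; rewrite inE mem_imset.
have imKV : cancel (fun h : {set 'I_n} => s @^-1: h) (fun h => s @: h).
  move=> h; apply/setP => i.
  by rewrite -[i in LHS](permKV s) mem_imset // inE permKV.
rewrite /elem_sym raddf_sum /=.
rewrite [RHS](reindex (fun h : {set 'I_n} => s @: h)) /=; last first.
  by exists (fun h : {set 'I_n} => s @^-1: h) => h _; [apply: imK | apply: imKV].
apply: eq_big => [h|h _].
  by rewrite card_imset // sub_imset_pre imK.
rewrite rmorph_prod big_imset /=; last by move=> i j _ _; apply: sI.
by apply: eq_bigr => i _; apply: msymXi.
Qed.

End PolynomialModule.

Definition is_partition (k : nat) (la : seq nat) : bool :=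
  [&& sorted geq la, 0%N \notin la & sumn la == k].

(* lambda'_j, for j >= 1 *)
Definition conj_part (la : seq nat) (j : nat) : nat :=
  count (fun x => j <= x)%N la.

(* p^n_m(lambda) *)
Definition conj_tail (n : nat) (la : seq nat) (m : nat) : nat :=
  (\sum_((n - m).+1 <= j < n.+1) conj_part la j)%N.

(* The inequality d > |S| - p is written additively, so that no truncated
   subtraction is involved. *)
Variant I_gens (n : nat) (la : seq nat) (s : nat) : {mpoly rat[n]} -> Prop :=
| I_gens_pow (i : 'I_n) : I_gens la s ('X_i ^+ s)
| I_gens_elem_sym (S : {set 'I_n}) (d : nat) of (0 < d)%N
    & (#|S| < d + conj_tail n la #|S|)%N : I_gens la s (elem_sym S d).

(* The sum of two generated ideals is generated by the union of the generators. *)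
Notation I_ideal n la s := (ideal_gen (@I_gens n la s)).

Lemma I_ideal_stable (n : nat) (la : seq nat) (s : nat) f (g : 'S_n) :
  f \in I_ideal n la s -> mpoly_module n f g \in I_ideal n la s.
Proof.
move=> /ideal_genP[c Gc ->]; apply/ideal_genP.
exists [seq (msym g u.1, msym g u.2) | u <- c].
  move=> _ /mapP[u /Gc Gu ->] /=; case: Gu => [i|S d d0 ltd].
    by rewrite rmorphXn /= msymXi; apply: I_gens_pow.
  rewrite msym_elem_sym; apply: I_gens_elem_sym => //.
  by rewrite card_imset //; apply: perm_inj.
rewrite big_map /= /mpoly_act raddf_sum; apply: eq_bigr => u _.
exact: rmorphM.
Qed.

Definition R_module (n : nat) (la : seq nat) (s : nat) :
    linear_action 'S_n {ideal_quot I_ideal n la s} :=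
  quot_module (@I_ideal_stable n la s).

Section Points.
Variables (n s : nat) (la : seq nat) (alpha : 'I_s -> rat).

(* Indices are shifted: alpha i stands for alpha_(i+1), nth 0 la i for
   lambda_(i+1). *)
Definition in_X (p : 'rV[rat]_n) : bool :=
  [forall i, p 0 i \in codom alpha] &&
  [forall j : 'I_s, nth 0%N la j <= #|[set i | p 0%R i == alpha j]|]%N.

(* The points need no finiteness structure: {freeg X_set / rat} consists of the
   finitely supported formal rational combinations of points. *)
Definition X_set := {p : 'rV[rat]_n | in_X p}.

Lemma in_X_perm p (g : 'S_n) : in_X p -> in_X (col_perm g^-1%g p).
Proof.
move=> /andP[/forallP pa /forallP pl]; apply/andP; split; apply/forallP => i.
  by rewrite mxE.
apply: leq_trans (pl i) _.
rewrite -(card_imset _ (@perm_inj _ g)); apply/subset_leq_card/subsetP => x.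
by case/imsetP => j + ->; rewrite !inE mxE permK.
Qed.

(* (p . g)_(g i) = p_i *)
Definition X_act (p : X_set) (g : 'S_n) : X_set :=
  exist _ (col_perm g^-1%g (val p)) (in_X_perm g (valP p)).

Lemma X_act_is_action : is_action [set: 'S_n] X_act.
Proof.
apply: is_total_action => [p|p g h]; apply: val_inj => /=.
  by rewrite invg1 col_perm1.
by rewrite invMg col_permM.
Qed.

Definition X_action : {action 'S_n &-> X_set} := Action X_act_is_action.

Definition QX_module : linear_action 'S_n {freeg X_set / rat} :=
  perm_module rat X_action.

End Points.

Arguments QX_module n {s} la alpha.

(* Main.v *)
From HB Require Import structures.
Require Import Defs.
From mathcomp Require Import all_boot all_fingroup all_algebra.
From mathcomp Require Import boolp.
From mathcomp Require Import zify.
From mathcomp Require Import freeg mpoly.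

(** Write A for the polynomial ring, I for the ideal and X for the set of
    points. The proof compares A / I with the space V of functions on X, on
    which evaluation of polynomials is onto and commutes with the symmetric
    group.

    Each homogeneous generator of I is the top-degree part of a polynomial
    vanishing on X. For the power of a variable this is clear ([powX_lower]).
    For the elementary symmetric polynomial e_d(S), let mu_j be the number
    of times that alpha_j is bound to occur among the coordinates in S. At a
    point of X the product of the factors 1 + x_i t, for i in S, is a multiple
    of D(t), the product of the (1 + alpha_j t)^mu_j, hence its product with
    the inverse series of D is a polynomial of degree at most |S| minus the sum
    of the mu_j. This bound is less than d, and the vanishing of the
    coefficient of t^d is the required relation ([elem_sym_lower]).

    Filter V by the images V_d of the polynomials of degree less than d. Since
    the group algebra is semisimple there are equivariant projections P_d of V
    onto V_d; mapping f homogeneous of degree d to ev(f) - P_d(ev(f)) defines an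
    equivariant linear map from A onto V ([exists_graded_map]), which kills I by
    the preceding paragraph. It remains to see that A / I is spanned by |X|
    elements, for then the map from A / I onto V is bijective
    ([spanned_kernel]).

    Points of X are encoded by words in the indices of the alphas. The spanning
    set is built by induction on a set T of active variables, inside the fixed
    ring A: the restricted ideal of T and la contains the variables outside T
    and the generators of I formed with the variables in T. If t is in T,
    la^(j) is la with its j-th part decreased by one, and at most r parts
    of la exceed la_j, then multiplication by x_t^r sends the restricted ideal
    of T \ t and la^(j) into that of T and la, up to multiples of x_t^(r+1)
    ([restricted_ideal_shift]). Taking for r the rank of j among the parts
    gives a filtration by powers of x_t whose s layers are spanned by the
    spanning sets for the la^(j), just as a word is a first letter j followed
    by a word with la^(j) as lower bound on its letter counts
    ([words_span_quotient]). *)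

Set Implicit Arguments.
Unset Strict Implicit.
Unset Printing Implicit Defensive.

Import generic_quotient GRing.Theory.

(** * Generated ideals *)

Section IdealMembership.
Local Open Scope ring_scope.
Context (F : fieldType) (A : comAlgType F) (G : A -> Prop).

Lemma mem_ideal_gen g : G g -> g \in ideal_gen G.
Proof.
move=> Gg; apply/ideal_genP; exists [:: (1, g)]; last by rewrite big_seq1 mul1r.
by move=> u; rewrite inE => /eqP ->.
Qed.

Lemma ideal_gen_sub (B : {pred A}) (f : A) :
    0 \in B -> {in B &, forall x y, x + y \in B} ->
    (forall a g, G g -> a * g \in B) ->
  f \in ideal_gen G -> f \in B.
Proof.
move=> B0 BD BG /ideal_genP[c Gc ->].
elim: c Gc => [|u c IHc] Gc; first by rewrite big_nil.
rewrite big_cons BD //; first by apply/BG/Gc; rewrite mem_head.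
by apply: IHc => v cv; apply: Gc; rewrite inE cv orbT.
Qed.

End IdealMembership.

(** * Elementary symmetric polynomials *)

Section ElementarySymmetric.
Local Open Scope ring_scope.
Context (n : nat).
Implicit Types (S T : {set 'I_n}) (t : 'I_n).

Lemma elem_sym0 S : elem_sym S 0 = 1 :> {mpoly rat[n]}.
Proof.
rewrite /elem_sym (big_pred1 set0) ?big_set0 // => h /=.
by rewrite cards_eq0; case: eqP => [->|]; rewrite ?sub0set ?andbF.
Qed.

Lemma elem_symU1 S t d : t \notin S ->
  elem_sym (t |: S) d.+1 = elem_sym S d.+1 + 'X_t * elem_sym S d.
Proof.
move=> tS; rewrite /elem_sym (bigID (fun h : {set 'I_n} => t \in h)) /= addrC.
congr (_ + _).
  by apply: eq_bigl => h; rewrite andbAC -subsetD1 setU1K.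
rewrite mulr_sumr [LHS](reindex_onto (fun h : {set 'I_n} => t |: h)
   (fun h : {set 'I_n} => h :\ t)) /=; last first.
  by move=> h /andP[_ th]; rewrite setD1K.
apply: eq_big => [h|h /andP[_ /eqP Eh]]; last first.
  by rewrite big_setU1 // -Eh setD11.
rewrite setU11 andbT; apply/andP/andP => [[/andP[hS hd] /eqP Eh]|[hS /eqP hd]].
  have th : t \notin h by rewrite -Eh setD11.
  move: hd; rewrite cardsU1 th eqSS => ->; split=> //.
  by rewrite -Eh -(setU1K tS) setSD.
have th : t \notin h by apply: contra tS; apply: subsetP.
by rewrite setUS // cardsU1 th hd eqxx setU1K.
Qed.

End ElementarySymmetric.

(** * A spanning set for the quotient *)

Section Spanning.
Local Open Scope ring_scope.
Context (n s : nat).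
Local Notation A := {mpoly rat[n]}.
Implicit Types (la : 'I_s -> nat) (S T : {set 'I_n}) (t : 'I_n).

(** Generators of the restricted ideal of a set [T] of active variables and of
    lower bounds [la]. The degree [d = 0] is allowed, so that the ideal is the
    whole ring when the bounds in [la] add up to more than [#|T|], that is, when
    no word of length [#|T|] satisfies them. *)
Variant restricted_gens T la : A -> Prop :=
| restricted_gens_out i of i \notin T : restricted_gens T la 'X_i
| restricted_gens_pow i : restricted_gens T la ('X_i ^+ s)
| restricted_gens_elem_sym S d of S \subset T
    & (#|S| < d + \sum_j (la j - (#|T| - #|S|)))%N : restricted_gens T la (elem_sym S d).

Notation K T la := (ideal_gen (restricted_gens T la)).

(** [la] with its [j]-th entry decreased by one, unless it is already zero. *)
Definition decr la (j : 'I_s) : 'I_s -> nat := fun l => (la l - (j == l))%N.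

Lemma sum_decr la j c :
  (\sum_l (decr la j l - c) + (c < la j) = \sum_l (la l - c))%N.
Proof.
rewrite (bigD1 j) //= [in RHS](bigD1 j) //= /decr eqxx.
under eq_bigr => l /negPf lj do rewrite eq_sym lj subn0.
by rewrite addnAC; congr addn; lia.
Qed.

Lemma sum_subn_succ la c :
  (\sum_l (la l - c) = \sum_l (la l - c.+1) + #|[set l | c < la l]|)%N.
Proof.
rewrite cardsE -sum1_card [X in (_ + X)%N]big_mkcond -big_split /=.
by apply: eq_bigr => l _; rewrite unfold_in /=; case: ifP; lia.
Qed.

(** The case of a generator, to which [restricted_ideal_shift] reduces by
    linearity. *)
Lemma restricted_gens_shift T la t (j : 'I_s) (r : nat) g :
    t \in T -> (#|[set l | la j < la l]| <= r)%N ->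
    restricted_gens (T :\ t) (decr la j) g ->
  exists h, 'X_t ^+ r * g - 'X_t ^+ r.+1 * h \in K T la.
Proof.
move=> tT le_r [i|i|S d ST].
- rewrite !inE negb_and negbK => /orP[/eqP ->|iT].
    by exists 1; rewrite mulr1 exprSr subrr rpred0.
  exists 0; rewrite mulr0 subr0; apply: ideal_genM; apply: mem_ideal_gen.
  exact: restricted_gens_out.
- exists 0; rewrite mulr0 subr0; apply: ideal_genM; apply: mem_ideal_gen.
  exact: restricted_gens_pow.
have [ST' tS] : S \subset T /\ t \notin S by apply/andP; rewrite -subsetD1.
have cT : #|T| = #|T :\ t|.+1 by rewrite (cardsD1 t) tT.
have le_ST := subset_leq_card ST.
set c := (#|T :\ t| - #|S|)%N.
have Ec : (#|T| - #|S| = c.+1)%N by rewrite cT subSn.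
have cU : #|t |: S| = #|S|.+1 by rewrite cardsU1 tS.
have EcU : (#|T| - #|t |: S| = c)%N by rewrite cT cU subSS.
have tST : t |: S \subset T by rewrite subUset sub1set tT.
have := sum_decr la j c; have := sum_subn_succ la c.
case: (ltnP c (la j)) => [lt_c|le_c] E1 E2 lt_d.
  have : elem_sym (t |: S) d \in K T la.
    by apply: mem_ideal_gen; apply: restricted_gens_elem_sym; rewrite ?EcU ?cU //; lia.
  (* e_d(S + t) = e_d(S) + x_t e_(d-1)(S) lies in the ideal, so x_t^r e_d(S) is
     a multiple of x_t^(r+1) modulo the ideal. *)
  case: d {lt_d} => [|d]; rewrite ?elem_symU1 ?elem_sym0 // => Ke.
    by exists 0; rewrite mulr0 subr0; apply: ideal_genM.
  exists (- elem_sym S d).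
  by rewrite mulrN opprK exprSr -mulrA -mulrDr; apply: ideal_genM.
(* Here e_(d'+1)(S + t) lies in the ideal for all d' >= d, so multiplying by x_t
   turns e_d'(S) into - e_(d'+1)(S) modulo the ideal; after a <= r steps
   e_(d+a)(S) is itself a generator. *)
exists 0; rewrite mulr0 subr0.
have le_a : (#|[set l | c < la l]| <= r)%N.
  apply: leq_trans le_r; apply/subset_leq_card/subsetP => l.
  by rewrite !inE; apply: leq_ltn_trans.
move: le_a E1; set a := #|_| => le_a E1.
have KU d' : (d <= d')%N -> elem_sym S d'.+1 + 'X_t * elem_sym S d' \in K T la.
  move=> le_d; rewrite -elem_symU1 //; apply: mem_ideal_gen.
  by apply: restricted_gens_elem_sym; rewrite // EcU cU; lia.
have shift b : 'X_t ^+ b * elem_sym S d - (-1) ^+ b * elem_sym S (d + b) \in K T la.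
  elim: b => [|b IHb]; first by rewrite !mul1r addn0 subrr rpred0.
  have -> : 'X_t ^+ b.+1 * elem_sym S d - (-1) ^+ b.+1 * elem_sym S (d + b.+1)
     = 'X_t * ('X_t ^+ b * elem_sym S d - (-1) ^+ b * elem_sym S (d + b))
       + (-1) ^+ b * (elem_sym S (d + b).+1 + 'X_t * elem_sym S (d + b)).
    rewrite addnS !exprS mulN1r mulNr opprK mulrBr mulrDr !mulrA.
    by rewrite ['X_t * (-1) ^+ b]mulrC [X in _ = _ + X]addrC addrA subrK.
  by rewrite rpredD //; apply: ideal_genM => //; apply: KU; rewrite leq_addr.
rewrite -(subnK le_a) exprD -mulrA; apply: ideal_genM.
rewrite -[X in X \in _](subrK ((-1) ^+ a * elem_sym S (d + a))).
rewrite rpredD ?shift //; apply: ideal_genM; apply: mem_ideal_gen.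
by apply: restricted_gens_elem_sym; rewrite // Ec; lia.
Qed.

Lemma restricted_ideal_shift T la t (j : 'I_s) (r : nat) f :
    t \in T -> (#|[set l | la j < la l]| <= r)%N ->
    f \in K (T :\ t) (decr la j) ->
  exists h, 'X_t ^+ r * f - 'X_t ^+ r.+1 * h \in K T la.
Proof.
move=> tT le_r Kf.
pose B := [pred f | `[< exists h, 'X_t ^+ r * f - 'X_t ^+ r.+1 * h \in K T la >]].
suff: f \in B by move/asboolP.
apply: ideal_gen_sub Kf => [|x y|a g Gg].
- by apply/asboolP; exists 0; rewrite !mulr0 subr0 rpred0.
- move=> /asboolP[h Kh] /asboolP[h' Kh']; apply/asboolP; exists (h + h').
  by rewrite !mulrDr opprD addrACA rpredD.
have [h Kh] := restricted_gens_shift tT le_r Gg; apply/asboolP; exists (a * h).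
by rewrite !(mulrCA _ a) -mulrBr; apply: ideal_genM.
Qed.

(** Every letter [j] occurs at least [la j] times in the word [w]. *)
Definition content_ge la m (w : m.-tuple 'I_s) : bool :=
  [forall j, la j <= count_mem j w]%N.

Lemma content_ge_cons la m j (w : m.-tuple 'I_s) :
  content_ge la [tuple of j :: w] = content_ge (decr la j) w.
Proof. by apply: eq_forallb => l /=; rewrite leq_subLR. Qed.

(** Sorting the letters by decreasing [la] gives each of them a rank. *)
Lemma exists_rank la :
  exists2 r : 'I_s -> 'I_s, bijective r & forall j, (#|[set l | la j < la l]| <= r j)%N.
Proof.
pose ge_la := [rel a b : 'I_s | la b <= la a]%N.
pose e := sort ge_la (enum 'I_s).
have eP : perm_eq e (enum 'I_s) by rewrite perm_sort.
have Ue : uniq e by rewrite (perm_uniq eP) enum_uniq.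
have se : size e = s by rewrite (perm_size eP) size_enum_ord.
have me j : j \in e by rewrite (perm_mem eP) mem_enum.
have lt_e j : (index j e < s)%N by rewrite -[X in (_ < X)%N]se index_mem.
exists (fun j => Ordinal (lt_e j)).
  apply: injF_bij => i j /(congr1 val) /= Eij.
  by rewrite -(nth_index i (me i)) Eij nth_index.
move=> j /=; rewrite cardE; set L := enum _.
have -> : (index j e = size (take (index j e) e))%N.
  by rewrite size_take; case: ltnP => //; rewrite se leqNgt lt_e.
apply: uniq_leq_size; first exact: enum_uniq.
move=> l; rewrite mem_enum inE => lt_jl; rewrite in_take // ltnNge.
apply: contraL lt_jl => le_jl; rewrite -leqNgt.
have ge_tr : transitive ge_la by move=> x y z /= yx xz; apply: leq_trans xz yx.
have e_sorted : sorted ge_la e by apply: sort_sorted => x y; apply: leq_total.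
have := sorted_leq_nth ge_tr (fun x => leqnn (la x)) j e_sorted _ _ _ _ le_jl.
by rewrite !inE !index_mem !nth_index //; apply.
Qed.

(** One inductive step: the spanning sets for the [decr la j], multiplied by the
    powers of ['X_t] given by the ranks, span modulo the ideal of [T] and [la]. *)
Lemma words_span_step T la t m (b : 'I_s -> m.-tuple 'I_s -> A) (r : 'I_s -> 'I_s)
    (bB : forall j f, exists c : m.-tuple 'I_s -> rat,
       f - \sum_(w | content_ge (decr la j) w) c w *: b j w
         \in K (T :\ t) (decr la j)) :
  t \in T -> bijective r -> (forall j, #|[set l | la j < la l]| <= r j)%N ->
  forall f, exists c : m.+1.-tuple 'I_s -> rat,
    f - \sum_(w | content_ge la w)
           c w *: ('X_t ^+ r (thead w) * b (thead w) (behead_tuple w)) \in K T la.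
Proof.
move=> tT [r' rK r'K] le_r.
pose B (w : m.+1.-tuple 'I_s) : A := 'X_t ^+ r (thead w) * b (thead w) (behead_tuple w).
(* Descending induction on the power s - k of x_t, starting from x_t^s = 0. *)
suff H k f : (k <= s)%N -> exists c : m.+1.-tuple 'I_s -> rat,
    'X_t ^+ (s - k) * f - \sum_(w | content_ge la w) c w *: B w \in K T la.
  by move=> f; have [c] := H s f (leqnn s); rewrite subnn mul1r; exists c.
elim: k f => [|k IHk] f lt_k.
  exists (fun=> 0); rewrite big1 => [|w _]; last by rewrite scale0r.
  rewrite subr0 subn0 mulrC; apply: ideal_genM; apply: mem_ideal_gen.
  exact: restricted_gens_pow.
have lt_i : (s - k.+1 < s)%N by rewrite -subn_gt0 subKn.
pose j := r' (Ordinal lt_i).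
have rj : r j = (s - k.+1)%N :> nat by rewrite r'K.
have [c1 Kc1] := bB j f.
have [h Kh] := restricted_ideal_shift tT (le_r j) Kc1.
have [c2] := IHk h (ltnW lt_k).
rewrite -subSS subSn // -rj => Kc2.
exists (fun w => (if thead w == j then c1 (behead_tuple w) else 0) + c2 w).
have Ec1 : \sum_(w : m.+1.-tuple 'I_s | content_ge la w)
     (if thead w == j then c1 (behead_tuple w) else 0) *: B w
   = 'X_t ^+ r j * \sum_(w | content_ge (decr la j) w) c1 w *: b j w.
  rewrite (bigID (fun w : m.+1.-tuple 'I_s => thead w == j)) /=.
  rewrite [X in _ + X]big1 ?addr0 => [|w /andP[_ /negPf ->]]; last first.
    by rewrite scale0r.
  rewrite (reindex_onto (fun w : m.-tuple 'I_s => [tuple of j :: w])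
     (fun w => behead_tuple w)) /=; last first.
    by move=> w /andP[_ /eqP <-]; rewrite [RHS]tuple_eta; apply: val_inj.
  rewrite mulr_sumr; apply: eq_big => w.
    rewrite content_ge_cons theadE eqxx andbT -[RHS]andbT; congr (_ && _).
    by apply/eqP/val_inj.
  move=> _; rewrite theadE eqxx /B theadE -scalerAr.
  by congr (c1 _ *: (_ * b j _)); apply: val_inj.
under eq_bigr => w _ do rewrite scalerDl.
rewrite big_split /= Ec1.
set S1 := \sum_(w | content_ge _ _) _ in Kh *.
set S2 := \sum_(w | content_ge _ _) _ in Kc2 *.
have -> : 'X_t ^+ r j * f - ('X_t ^+ r j * S1 + S2)
   = ('X_t ^+ r j * (f - S1) - 'X_t ^+ (r j).+1 * h) + ('X_t ^+ (r j).+1 * h - S2).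
  by rewrite mulrBr opprD !addrA subrK.
by rewrite rpredD.
Qed.

Lemma words_span_quotient m T la : #|T| = m ->
  exists b : m.-tuple 'I_s -> A, forall f, exists c : m.-tuple 'I_s -> rat,
    f - \sum_(w | content_ge la w) c w *: b w \in K T la.
Proof.
elim: m T la => [|m IHm] T la cT.
  (* All variables lie in the ideal, which is everything unless la = 0. *)
  have {cT}T0 : T = set0 by apply/eqP; rewrite -cards_eq0 cT.
  exists (fun=> 1) => f; case: (boolP (content_ge la [tuple])) => la0; last first.
    exists (fun=> 0); rewrite big1 => [|w _]; last by rewrite scale0r.
    rewrite subr0 -[f]mulr1; apply: ideal_genM; apply: mem_ideal_gen.
    rewrite -(elem_sym0 set0); apply: restricted_gens_elem_sym; rewrite ?sub0set //.
    rewrite T0 cards0 add0n subnn lt0n.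
    apply: contra la0; rewrite sum_nat_eq0 => /forallP la0.
    by apply/forallP => j; have := la0 j; rewrite subn0 /= => /eqP ->.
  exists (fun=> f@_0%MM); rewrite (big_pred1 [tuple]); last first.
    by move=> w; rewrite tuple0 la0; apply/esym/eqP/val_inj.
  elim/mpolyind: f => [|c x f xf c0 IHf]; first by rewrite mcoeff0 scale0r subrr rpred0.
  rewrite mcoeffD scalerDl opprD addrACA rpredD //.
  rewrite mcoeffZ mcoeffX -scalerA -scalerBr; apply: ideal_genZ.
  have [->|x0] := eqVneq x 0%MM; first by rewrite mpolyX0 scale1r subrr rpred0.
  rewrite scale0r subr0.
  have [i xi] : exists i, x i != 0%N.
    apply/existsP; apply: contraNT x0 => /existsPn x0; apply/eqP/mnmP => i.
    by rewrite mnm0E; apply/eqP; have := x0 i; rewrite negbK.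
  have le_ix : (U_(i) <= x)%MM by rewrite lep1mP.
  rewrite -(submK le_ix) mpolyXD; apply: ideal_genM; apply: mem_ideal_gen.
  by apply: restricted_gens_out; rewrite T0 inE.
have /card_gt0P[t tT] : (0 < #|T|)%N by rewrite cT.
have cTt : #|T :\ t| = m by move: cT; rewrite (cardsD1 t) tT => -[].
have [r r_bij le_r] := exists_rank la.
have [b bP] := choice (fun j => IHm (T :\ t) (decr la j) cTt).
exists (fun w => 'X_t ^+ r (thead w) * b (thead w) (behead_tuple w)).
exact: words_span_step.
Qed.

End Spanning.

(** * Tails of the conjugate partition *)

Section ConjugateTail.
Implicit Types (n m c k s : nat) (la : seq nat).

Lemma sum_nth_subn la s c : size la <= s ->
  \sum_(j < s) (nth 0 la j - c) = \sum_(x <- la) (x - c).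
Proof.
move=> /subnKC <-; rewrite big_split_ord /= [X in _ + X]big1 ?addn0 => [|i _].
  by rewrite [RHS](big_nth 0) big_mkord.
by rewrite nth_default ?leq_addr.
Qed.

Lemma conj_tailE n m la : m <= n -> {in la, forall x, x <= n} ->
  conj_tail n la m = \sum_(x <- la) (x - (n - m)).
Proof.
move=> le_mn; rewrite /conj_tail /conj_part.
elim: la => [|x la IHla] le_n; first by rewrite big_nil big1_eq.
rewrite big_cons /= big_split /= IHla => [|y yla]; last first.
  by apply: le_n; rewrite inE yla orbT.
congr addn; have le_xn : x <= n by apply: le_n; rewrite mem_head.
have := @big_nat_widen nat 0 addn (n - m).+1 x.+1 n.+1 xpredT (fun=> 1) le_xn.
rewrite sum_nat_const_nat muln1 subSS /= => ->.
by rewrite [RHS]big_mkcond; apply: eq_bigr => j _; rewrite ltnS; case: leqP.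
Qed.

Lemma sum_subn_le la c : \sum_(x <- la) (x - c) <= sumn la - c.
Proof.
elim: la => [|x la IHla]; first by rewrite big_nil.
rewrite big_cons /=.
have : \sum_(y <- la) (y - c) <= sumn la.
  by rewrite sumnE leq_sum // => y _; apply: leq_subr.
case: (leqP x c); lia.
Qed.

End ConjugateTail.

(** * Generators as top-degree parts of vanishing polynomials *)

Section TopDegree.
Local Open Scope ring_scope.
Context (n s : nat) (alpha : 'I_s -> rat).
Implicit Types (S : {set 'I_n}) (la : 'I_s -> nat) (w : n.-tuple 'I_s).

(** The point whose coordinates are the [alpha]s indexed by the letters of [w]. *)
Definition word_point w : 'I_n -> rat := fun i => alpha (tnth w i).

Lemma count_tnth m (w : m.-tuple 'I_s) j : count_mem j w = #|[set i | tnth w i == j]|.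
Proof.
rewrite -sum1_count big_tuple -sum1_card.
by apply: eq_bigl => i; rewrite inE.
Qed.

Lemma msize_dhomog d (f : {mpoly rat[n]}) : f \is d.-homog -> (msize f <= d.+1)%N.
Proof.
move=> /dhomogP f_d; rewrite msizeE big_tnth; apply/bigmax_leqP => i _.
by rewrite ltnS f_d ?mem_tnth.
Qed.

Lemma elem_sym_dhomog S d : elem_sym S d \is d.-homog.
Proof.
apply: rpred_sum => h /andP[_ /eqP <-].
rewrite mprodXE dhomogX /= mdeg_sum (eq_bigr (fun=> 1%N)); first by rewrite sum1_card.
by move=> i _; rewrite mdeg1.
Qed.

Lemma powX_dhomog (i : 'I_n) d : ('X_i ^+ d : {mpoly rat[n]}) \is d.-homog.
Proof. by rewrite mpolyXn dhomogX /= mdegMn mdeg1 mul1n. Qed.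

Lemma meval_elem_sym (x : 'I_n -> rat) S d :
  (elem_sym S d).@[x] = (\prod_(i in S) (1 + x i *: 'X) : {poly rat})`_d.
Proof.
have -> : \prod_(i in S) (1 + x i *: 'X : {poly rat})
    = \prod_i ((if i \in S then x i else 0) *: 'X + 1).
  rewrite big_mkcond; apply: eq_bigr => i _.
  by case: ifP => _; rewrite ?scale0r ?add0r // addrC.
rewrite bigA_distr coef_sum /elem_sym raddf_sum /= big_mkcond.
apply: eq_bigr => h _.
transitivity
  ((if #|h| == d then \prod_(i in h) (if i \in S then x i else 0) else 0) : rat).
  case: (boolP (h \subset S)) => hS /=.
    case: eqP => // _; rewrite rmorph_prod; apply: eq_bigr => i ih /=.
    by rewrite mevalXU (subsetP hS).
  case: eqP => // _; have /subsetPn[i ih iS] := hS.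
  by rewrite (bigD1 i) //= (negPf iS) mul0r.
rewrite -big_mkcond /= scaler_prod prodr_const coefZ coefXn eq_sym.
by case: eqP; rewrite ?mulr1 ?mulr0.
Qed.

(** A polynomial with constant term 1 is invertible as a power series; [C] is
    the inverse truncated beyond degree [d]. *)
Lemma poly_inv_mod (D : {poly rat}) d : D`_0 = 1 ->
  exists2 C : {poly rat}, C`_0 = 1 &
    forall (Q : {poly rat}) j, (j <= d)%N -> (D * Q * C)`_j = Q`_j.
Proof.
move=> D0; pose C := \sum_(i < d.+1) (1 - D) ^+ i.
have DC : D * C = 1 - (1 - D) ^+ d.+1.
  by rewrite -[RHS]opprB subrX1 -mulNr opprB opprB addrC subrK.
have [E DE] : exists E, 1 - D = 'X * E.
  have : 'X %| 1 - D.
    rewrite -['X]subr0 dvdp_XsubCl /root horner_coef0 coefB coef1 D0 /=.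
    by rewrite subrr.
  by rewrite dvdp_eq => /eqP {1}->; exists ((1 - D) %/ 'X); rewrite mulrC.
exists C => [|Q j le_jd].
  have := congr1 (fun p : {poly rat} => p`_0) DC.
  by rewrite /= coefB coef1 coef0M D0 mul1r DE exprMn coefXnM subr0.
rewrite mulrAC DC mulrBl mul1r coefB DE exprMn -mulrA coefXnM ltnS le_jd.
exact: subr0.
Qed.

Lemma size_prod_leq_sum (I : finType) (P : pred I) (D : I -> {poly rat}) (e : I -> nat) :
  (forall i, P i -> size (D i) <= (e i).+1)%N ->
  (size (\prod_(i | P i) D i)%R <= (\sum_(i | P i) e i).+1)%N.
Proof.
move=> le_e; elim/big_rec2: _ => [|i m p Pi le_p]; first by rewrite size_poly1.
by have := poly.size_polyMleq (D i) p; have := le_e i Pi; lia.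
Qed.

(** On the points satisfying the bounds [la], the generator [elem_sym S d] agrees
    with a polynomial of smaller degree. *)
Lemma elem_sym_lower S la d : (#|S| < d + \sum_j (la j - (n - #|S|)))%N ->
  exists2 h : {mpoly rat[n]}, (msize h <= d)%N &
    forall w, content_ge la w ->
      (elem_sym S d).@[word_point w] = h.@[word_point w].
Proof.
move=> lt_d; pose mu j := (la j - (n - #|S|))%N.
pose D : {poly rat} := \prod_j (1 + alpha j *: 'X) ^+ mu j.
have D0 : D`_0 = 1.
  rewrite coef0_prod big1 // => j _; rewrite -[LHS]/(coefp 0 _) rmorphXn /=.
  by rewrite coefD coefZ coefX coef1 mulr0 addr0 expr1n.
have [C C0 DC] := poly_inv_mod d D0.
exists (- \sum_(j < d) C`_(d - j) *: elem_sym S j).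
  rewrite msizeN; apply: leq_trans (msize_sum _ _ _) _.
  apply/bigmax_leqP => j _; apply: leq_trans (msizeZ_le _ _) _.
  exact: leq_trans (msize_dhomog (elem_sym_dhomog S j)) (ltn_ord j).
(* At most n - |S| occurrences of the letter j lie outside S. *)
move=> w w_ge; pose c j := #|[set i in S | tnth w i == j]|.
have le_mu j : (mu j <= c j)%N.
  have /forallP/(_ j) := w_ge; rewrite count_tnth /mu /c => le_j.
  have : (#|[set i | tnth w i == j]| <= #|[set i in S | tnth w i == j]| + #|~: S|)%N.
    apply: leq_trans (leq_card_setU _ _); apply/subset_leq_card/subsetP => i.
    by rewrite !inE => ->; rewrite andbT orbN.
  by have := cardsC S; rewrite card_ord; lia.
have sum_c : (\sum_j c j = #|S|)%N.
  rewrite -sum1_card (partition_big (tnth w) xpredT) //=; apply: eq_bigr => j _.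
  by rewrite /c -sum1_card; apply: eq_bigl => i; rewrite inE.
pose Q : {poly rat} := \prod_j (1 + alpha j *: 'X) ^+ (c j - mu j).
have ED : \prod_(i in S) (1 + word_point w i *: 'X) = D * Q.
  rewrite -big_split /= (partition_big (tnth w) xpredT) //=; apply: eq_bigr => j _.
  rewrite -exprD subnKC // /c -prodr_const; apply: eq_big => [i|i /andP[_ /eqP <-] //].
  by rewrite inE.
have sQ : (size Q <= d)%N.
  have : (size Q <= (\sum_j (c j - mu j)).+1)%N.
    apply: size_prod_leq_sum => j _; apply: leq_trans (size_poly_exp_leq _ _) _.
    rewrite ltnS -[X in (_ <= X)%N]mul1n leq_mul2r; apply/orP; right.
    have le2 : (size (1 + alpha j *: 'X)%R <= 2)%N.
      apply: leq_trans (size_polyD _ _) _; rewrite size_poly1 geq_max /=.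
      by rewrite (leq_trans (size_scale_leq _ _)) ?size_polyX.
    by case: (size _) le2.
  have : (\sum_j (c j - mu j) + \sum_j mu j = #|S|)%N.
    by rewrite -sum_c -big_split; apply: eq_bigr => j _; rewrite /= subnK.
  rewrite -/(mu _) in lt_d; rewrite /mu; lia.
(* Coefficient of t^d in D Q C; it is zero because size Q <= d. *)
have /eqP := DC Q d (leqnn d).
rewrite -ED [Q`_d]nth_default // coefM big_ord_recr /= subnn C0 mulr1.
rewrite meval_elem_sym addrC addr_eq0 => /eqP ->; rewrite mevalN; congr (- _).
rewrite raddf_sum; apply: eq_bigr => j _.
by rewrite /= mevalZ meval_elem_sym mulrC.
Qed.

(** The univariate polynomial with roots the [alpha]s, evaluated at ['X_i],
    vanishes at all points. *)
Lemma powX_lower (i : 'I_n) :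
  exists2 h : {mpoly rat[n]}, (msize h <= s)%N &
    forall w, ('X_i ^+ s).@[word_point w] = h.@[word_point w].
Proof.
pose P : {poly rat} := \prod_(j < s) ('X - (alpha j)%:P).
have sP : size P = s.+1.
  by rewrite size_prod_XsubC [index_enum _]unlock -enumT size_enum_ord.
have P1 : P`_s = 1.
  have /monicP := monic_prod_XsubC (index_enum 'I_s) xpredT alpha.
  by rewrite lead_coefE -/P sP.
exists (- \sum_(j < s) P`_j *: 'X_i ^+ j).
  rewrite msizeN; apply: leq_trans (msize_sum _ _ _) _.
  apply/bigmax_leqP => j _; apply: leq_trans (msizeZ_le _ _) _.
  exact: leq_trans (msize_dhomog (powX_dhomog i j)) (ltn_ord j).
move=> w; apply/eqP; rewrite -subr_eq0 mevalN opprK; apply/eqP.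
have : P.[word_point w i] = 0.
  by rewrite horner_prod (bigD1 (tnth w i)) //= hornerXsubC subrr mul0r.
rewrite horner_coef sP big_ord_recr /= P1 mul1r addrC; apply: etrans.
congr (_ + _); first by rewrite rmorphXn /= mevalXU.
rewrite raddf_sum; apply: eq_bigr => j _ /=.
by rewrite mevalZ rmorphXn /= mevalXU.
Qed.
End TopDegree.

(** * Linear actions and Maschke's theorem *)

Section LinearActionTheory.
Local Open Scope ring_scope.
Context (F : fieldType) (gT : finGroupType) (V : lmodType F).
Variable aV : linear_action gT V.

Lemma lact0 g : aV 0 g = 0.
Proof. by have := lact_linear aV g (-1) 0 0; rewrite !scaleN1r oppr0 addr0 addNr. Qed.

Lemma lactD g : {morph aV^~ g : u v / u + v}.
Proof. by move=> u v; have := lact_linear aV g 1 u v; rewrite !scale1r. Qed.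

Lemma lactZ g a u : aV (a *: u) g = a *: aV u g.
Proof. by have := lact_linear aV g a u 0; rewrite lact0 !addr0. Qed.

Lemma lact_sum g I (r : seq I) (P : pred I) (E : I -> V) :
  aV (\sum_(i <- r | P i) E i) g = \sum_(i <- r | P i) aV (E i) g.
Proof. exact: (big_morph (aV^~ g) (lactD g) (lact0 g)). Qed.

End LinearActionTheory.

Section Maschke.
Local Open Scope ring_scope.
Context (F : numFieldType) (gT : finGroupType) (V : vectType F).
Variables (aV : linear_action gT V) (U : {vspace V}).
Hypothesis aU : forall u g, u \in U -> aV u g \in U.

(** Averaging over the group turns any projection onto a stable subspace into an
    equivariant one. *)
Lemma exists_equivariant_projection : exists P : {linear V -> V},
  [/\ forall v, P v \in U, {in U, forall u, P u = u}
    & forall v g, P (aV v g) = aV (P v) g].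
Proof.
pose P v := (#|gT|%:R)^-1 *: \sum_g aV (projv U (aV v g)) g^-1%g.
have P_lin : linear P.
  move=> a u v; rewrite /P scalerA mulrC -scalerA -scalerDr; congr (_ *: _).
  rewrite scaler_sumr -big_split; apply: eq_bigr => g _ /=.
  by rewrite lactD lactZ linearP lactD lactZ.
pose PL : {linear V -> V} := HB.pack P (GRing.isLinear.Build F V V _ P P_lin).
exists PL; rewrite /= /P; split=> [v|u uU|v h].
- rewrite memvZ // memv_suml // => g _; apply: aU; exact: memv_proj.
- rewrite (eq_bigr (fun=> u)) => [|g _]; last first.
    by rewrite projv_id ?aU // -tactM mulgV tact1.
  rewrite sumr_const -scaler_nat scalerA mulVf ?scale1r //.
  rewrite Num.Theory.pnatr_eq0 -lt0n; apply/card_gt0P; by exists 1%g.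
rewrite lactZ lact_sum (reindex_inj (mulgI h^-1%g)) /=; congr (_ *: _).
by apply: eq_bigr => g _; rewrite -!tactM mulKVg invMg invgK.
Qed.

End Maschke.

(** * The associated graded of an evaluation map *)

Section AssociatedGraded.
Local Open Scope ring_scope.
Context (n : nat) (V : vectType rat) (aV : linear_action 'S_n V).
Local Notation A := {mpoly rat[n]}.
Variable ev : {linear A -> V}.
Hypothesis ev_act : forall f g, ev (msym g f) = aV (ev f) g.
Hypothesis ev_surj : forall v, exists f, ev f = v.

(** The image under [ev] of the polynomials of degree less than [d]. *)
Definition filtration d : {vspace V} :=
  (\sum_(m : 'X_{1..n < d}) <[ev 'X_[val m]]>)%VS.

Lemma mem_filtration d f : (msize f <= d)%N -> ev f \in filtration d.
Proof.
move=> le_d; rewrite (mpolywE le_d) raddf_sum memv_sumr // => m _ /=.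
by rewrite linearZ memvZ // memv_line.
Qed.

Lemma filtrationP d v :
  reflect (exists2 f, (msize f <= d)%N & ev f = v) (v \in filtration d).
Proof.
apply: (iffP idP) => [|[f le_d <-]]; last exact: mem_filtration.
move=> /memv_sumP[vs vsP ->].
have /choice[c cP] : forall m, exists c, vs m = c *: ev 'X_[val m].
  by move=> m; have /vlineP := vsP m isT.
exists (\sum_m c m *: 'X_[val m]).
  apply: leq_trans (msize_sum _ _ _) _; apply/bigmax_leqP => m _.
  by rewrite (leq_trans (msizeZ_le _ _)) // msizeX bmdeg.
by rewrite raddf_sum; apply: eq_bigr => m _; rewrite /= linearZ cP.
Qed.

Lemma msize_msym_le (f : A) (g : 'S_n) : (msize (msym g f) <= msize f)%N.
Proof.
rewrite {1}(mpolyE f) raddf_sum; apply: leq_trans (msize_sum _ _ _) _.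
rewrite big_seq; apply/bigmax_leqP_seq => m mf _ /=.
rewrite msymZ; apply: leq_trans (msizeZ_le _ _) _.
by rewrite msymX msizeX mdeg_mperm msize_mdeg_lt.
Qed.

Lemma filtration_act d v g : v \in filtration d -> aV v g \in filtration d.
Proof.
move=> /filtrationP[f le_d <-]; rewrite -ev_act; apply: mem_filtration.
exact: leq_trans (msize_msym_le f g) le_d.
Qed.

Lemma filtration_full : exists D, filtration D = fullv.
Proof.
have /choice[f fP] : forall i : 'I_(\dim {:V}), exists f, ev f = (vbasis {:V})`_i.
  by move=> i; apply: ev_surj.
exists (\max_i msize (f i)); apply/vspaceP => v; rewrite memvf.
rewrite (coord_vbasis (memvf v)) memv_suml // => i _; rewrite memvZ // -fP.
by apply: mem_filtration; apply: (leq_bigmax i).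
Qed.

(** An equivariant surjection that kills every homogeneous polynomial whose value
    is that of a polynomial of smaller degree: a homogeneous [f] of degree [d] is
    sent to [ev f] minus its equivariant projection to [filtration d]. *)
Lemma exists_graded_map : exists phi : {linear A -> V},
  [/\ forall f g, phi (msym g f) = aV (phi f) g, forall v, exists f, phi f = v
    & forall d f h, f \is d.-homog -> (msize h <= d)%N -> ev f = ev h -> phi f = 0].
Proof.
have [D D_full] := filtration_full.
have /choice[P P_proj] := fun d => exists_equivariant_projection (@filtration_act d).
(* Degrees d >= D contribute nothing, as P d is then the identity. *)
pose Phi f := \sum_(d < D) (ev (pihomog mdeg d f) - P d (ev (pihomog mdeg d f))).
have Phi_lin : linear Phi.
  move=> a f h; rewrite scaler_sumr -big_split; apply: eq_bigr => d _ /=.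
  by rewrite !linearP /= addrACA -scalerDr.
pose phi : {linear A -> V} := HB.pack Phi (GRing.isLinear.Build rat A V _ Phi Phi_lin).
have phi_homog d f : f \is d.-homog -> (d < D)%N -> phi f = ev f - P d (ev f).
  move=> f_d lt_d; rewrite /= /Phi (bigD1 (Ordinal lt_d)) //= pihomog_dE //.
  rewrite big1 ?addr0 // => e; rewrite -val_eqE /= eq_sym => /pihomog_ne0 -> //.
  by rewrite !linear0 addr0.
exists phi; split=> [f g|v|d f h f_d le_hd ev_fh].
- rewrite /= /Phi lact_sum; apply: eq_bigr => d _.
  have [_ _ P_act] := P_proj d.
  by rewrite -msym_pihomog ev_act P_act -scaleN1r -lactZ scaleN1r -lactD.
- (* Surjectivity onto each filtration step, by induction on the step: for f of
     degree d, ev f is phi of its top part plus an element of the previous one. *)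
  suff H d w : (d <= D)%N -> w \in filtration d -> exists f, phi f = w.
    by apply: (H D) => //; rewrite D_full memvf.
  elim: d w => [|d IHd] w lt_d /filtrationP[f le_fd <-].
    by exists 0; move: le_fd; rewrite leqn0 msize_poly_eq0 => /eqP ->; rewrite !linear0.
  have [Pd _ _] := P_proj d.
  have Ef : f = \sum_(e < d) pihomog mdeg e f + pihomog mdeg d f.
    rewrite {1}(pihomog_partitionE (k := d.+1) (mf := mdeg) le_fd).
    by rewrite big_ord_recr.
  have : ev (\sum_(e < d) pihomog mdeg e f) + P d (ev (pihomog mdeg d f)) \in filtration d.
    rewrite rpredD ?Pd // raddf_sum rpred_sum // => e _.
    apply: mem_filtration; apply: leq_trans (ltn_ord e).
    exact: msize_dhomog (pihomogP _ _ _).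
  case/(IHd _ (ltnW lt_d)) => f' Ef'; exists (f' + pihomog mdeg d f).
  rewrite linearD Ef' (phi_homog d) ?pihomogP // [in RHS]Ef [in RHS]linearD.
  by rewrite [_ - P d _]addrC addrA addrK.
case: (ltnP d D) => [lt_d|le_d]; last first.
  rewrite /= /Phi big1 // => e _.
  have ne_de : d != e by rewrite neq_ltn (leq_trans (ltn_ord e) le_d) orbT.
  by rewrite (pihomog_ne0 ne_de f_d) !linear0 addr0.
rewrite (phi_homog d) //; have [_ P_id _] := P_proj d.
by rewrite P_id ?subrr // ev_fh mem_filtration.
Qed.

End AssociatedGraded.

Section GradedKernel.
Local Open Scope ring_scope.
Context (n : nat) (V : vectType rat).
Local Notation A := {mpoly rat[n]}.
Variables (ev phi : {linear A -> V}).
Hypothesis ev_mul : forall a f h, ev f = ev h -> ev (a * f) = ev (a * h).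
Hypothesis phi_lower : forall d f h,
  f \is d.-homog -> (msize h <= d)%N -> ev f = ev h -> phi f = 0.

(** Split the multiplier [a] into homogeneous components: the product of each with
    [g] is homogeneous and agrees with a polynomial of smaller degree. *)
Lemma graded_map_mul_lower a d g h :
  g \is d.-homog -> (msize h <= d)%N -> ev g = ev h -> phi (a * g) = 0.
Proof.
move=> g_d le_hd ev_gh.
rewrite (pihomog_partitionE (mf := mdeg) (leqnn (msize a))) mulr_suml raddf_sum.
apply: big1 => e _ /=; set ae := pihomog _ _ _.
have ae_e : ae \is e.-homog by apply: pihomogP.
apply: (phi_lower (h := ae * h) (dhomogM ae_e g_d)); last exact: ev_mul.
have [->|h0] := eqVneq h 0; first by rewrite mulr0 msize0.
have [->|a0] := eqVneq ae 0; first by rewrite mul0r msize0.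
by rewrite msizeM // -subn1 leq_subLR add1n -addSn leq_add ?msize_dhomog.
Qed.

End GradedKernel.

(** * Isomorphisms from a quotient by an ideal *)

Section QuotientIsomorphism.
Local Open Scope ring_scope.
Context (F : fieldType) (A : comAlgType F) (G : A -> Prop) (gT : finGroupType).
Variables (aA : linear_action gT A) (W : lmodType F) (aW : linear_action gT W).
Hypothesis aA_stable : forall f g, f \in ideal_gen G -> aA f g \in ideal_gen G.

Lemma quot_module_iso (psi : {linear A -> W}) :
    (forall f g, psi (aA f g) = aW (psi f) g) ->
    (forall f, psi f = 0 <-> f \in ideal_gen G) -> (forall v, exists f, psi f = v) ->
  module_iso (quot_module aA_stable) aW.
Proof.
move=> psi_act psi_ker psi_surj.
pose Q := {ideal_quot ideal_gen G}.
pose bar (x : Q) := psi (repr x).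
have barE f : bar (\pi_Q f)%qT = psi f.
  apply/eqP; rewrite /bar -subr_eq0 -linearB; apply/eqP/psi_ker.
  by rewrite Quotient.idealrBE reprK.
have bar_lin : linear bar.
  move=> a; elim/quotW=> f; elim/quotW=> h.
  by rewrite -quot_pi_scale -raddfD !barE linearP.
pose L : {linear Q -> W} := HB.pack bar (GRing.isLinear.Build F Q W _ bar bar_lin).
exists L; split.
  have /choice[r rP] := psi_surj.
  exists (fun v => \pi_Q (r v))%qT => [|v]; last by rewrite /= barE rP.
  elim/quotW=> f; rewrite /= barE; apply/eqP.
  by rewrite -Quotient.idealrBE; apply/psi_ker; rewrite linearB rP subrr.
by move=> x g; elim/quotW: x => f; rewrite /= (quot_actE aA_stable) !barE psi_act.
Qed.

End QuotientIsomorphism.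

Section SpanningKernel.
Local Open Scope ring_scope.
Context (F : fieldType) (A : lmodType F) (K : zmodClosed A) (W : finType).
Variables (phi : {linear A -> {ffun W -> F^o}}) (b : W -> A).
Hypothesis phi_surj : forall v, exists f, phi f = v.
Hypothesis phiK : {in K, forall f, phi f = 0}.
Hypothesis b_span : forall f, exists c : W -> F, f - \sum_w c w *: b w \in K.

(** If [A / K] is spanned by as many elements as the dimension of the target, a
    surjection killing [K] has kernel exactly [K]. *)
Lemma spanned_kernel f : phi f = 0 -> f \in K.
Proof.
(* The endomorphism taking the w-th basis vector to phi (b w) is onto, hence
   injective. *)
pose L (v : {ffun W -> F^o}) := \sum_w v w *: phi (b w).
have L_lin : linear L.
  move=> a u v; rewrite /L scaler_sumr -big_split; apply: eq_bigr => w _.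
  by rewrite !ffunE scalerDl scalerA.
pose LL : {linear {ffun W -> F^o} -> {ffun W -> F^o}} :=
  HB.pack L (GRing.isLinear.Build F _ _ _ L L_lin).
have phiE g c : g - \sum_w c w *: b w \in K -> phi g = linfun LL (finfun c).
  move=> /phiK; rewrite linearB => /subr0_eq ->; rewrite lfunE raddf_sum /=.
  by apply: eq_bigr => w _; rewrite /= linearZ ffunE.
have L_full : limg (linfun LL) = fullv.
  apply/vspaceP => v; rewrite memvf; have [g <-] := phi_surj v.
  by have [c /phiE ->] := b_span g; apply/memv_img/memvf.
have L_inj : lker (linfun LL) == 0%VS.
  have := limg_ker_dim (linfun LL) fullv.
  by rewrite L_full capfv -dimv_eq0 => /(canRL (addnK _)) ->; rewrite subnn.
move=> f0; have [c Kc] := b_span f.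
have c0 : finfun c = 0 :> {ffun W -> F^o}.
  by move/lker0P: L_inj; apply; rewrite -(phiE f) // f0 linear0.
suff Ef : f = f - \sum_w c w *: b w by rewrite Ef.
rewrite big1 ?subr0 // => w _.
have := congr1 (fun v : {ffun W -> F^o} => v w) c0.
by rewrite !ffunE => ->; rewrite scale0r.
Qed.

End SpanningKernel.

(** * Functions on the set of points *)

Section PointsModule.
Local Open Scope ring_scope.
Context (n s : nat) (la : seq nat) (alpha : 'I_s -> rat).
Hypothesis alpha_inj : injective alpha.
Local Notation A := {mpoly rat[n]}.
Local Notation la_ := (fun j : 'I_s => nth 0%N la j).

(** The words with at least [nth 0 la j] occurrences of each letter [j]; they
    form a finite type in bijection with the set of points. *)
Definition word := {w : n.-tuple 'I_s | content_ge la_ w}.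
HB.instance Definition _ := Finite.on word.

Local Notation V := {ffun word -> rat^o}.

Lemma big_word (E : n.-tuple 'I_s -> A) :
  \sum_(w | content_ge la_ w) E w = \sum_(w : word) E (val w).
Proof.
rewrite (reindex_omap (val : word -> _) insub) => [|w w_ge]; last by rewrite insubT.
by apply: eq_bigl => w; rewrite valK eqxx andbT; apply: valP.
Qed.

Lemma content_ge_perm (w : n.-tuple 'I_s) (g : 'S_n) :
  content_ge la_ w -> content_ge la_ [tuple tnth w (g^-1%g i) | i < n].
Proof.
move=> /forallP w_ge; apply/forallP => j; apply: leq_trans (w_ge j) _.
rewrite !count_tnth -(card_imset _ (@perm_inj _ g)).
apply/subset_leq_card/subsetP => x /imsetP[i + ->].
by rewrite !inE tnth_mktuple permK.
Qed.

(** Permutation of the positions, with the convention of [X_act]. *)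
Definition word_act (w : word) (g : 'S_n) : word :=
  exist _ [tuple tnth (val w) (g^-1%g i) | i < n] (content_ge_perm g (valP w)).

Lemma word_point_act (w : word) g i :
  word_point alpha (val (word_act w g)) i = word_point alpha (val w) (g^-1%g i).
Proof. by rewrite /word_point tnth_mktuple. Qed.

(** The functions on words, as a linear action. *)
Definition fun_act (v : V) (g : 'S_n) : V := [ffun w => v (word_act w g^-1)].

Lemma fun_act_is_action : is_action [set: 'S_n] fun_act.
Proof.
apply: is_total_action => [v|v g h]; apply/ffunP => w; rewrite !ffunE.
  congr (v _); apply/val_inj/eq_from_tnth => i.
  by rewrite tnth_mktuple !invg1 perm1.
congr (v _); apply/val_inj/eq_from_tnth => i.
by rewrite !tnth_mktuple !invgK permM.
Qed.

Lemma fun_act_linear g : linear (fun_act^~ g).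
Proof. by move=> a u v; apply/ffunP => w; rewrite !ffunE. Qed.

Definition fun_module : linear_action 'S_n V :=
  LinearAction (V := V) (lact := Action fun_act_is_action) fun_act_linear.

(** Evaluation of a polynomial at all points. *)
Definition eval_words (f : A) : V := [ffun w => f.@[word_point alpha (val w)]].

Lemma eval_words_linear : linear eval_words.
Proof. by move=> a f h; apply/ffunP => w; rewrite !ffunE mevalD mevalZ. Qed.

HB.instance Definition _ :=
  GRing.isLinear.Build rat A V _ eval_words eval_words_linear.

Lemma meval_msym (x : 'I_n -> rat) (g : 'S_n) f :
  (msym g f).@[x] = f.@[fun i => x (g i)].
Proof.
elim/mpolyind: f => [|c m f _ _ IHf]; first by rewrite raddf0 !meval0.
rewrite raddfD !mevalD {}IHf; congr (_ + _).
rewrite /= msymZ !mevalZ; congr (_ * _).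
rewrite mpolyXE_id !rmorph_prod; apply: eq_bigr => i _ /=.
by rewrite !rmorphXn /= msymXi !mevalXU.
Qed.

Lemma eval_words_act f g : eval_words (msym g f) = fun_module (eval_words f) g.
Proof.
apply/ffunP => w; rewrite !ffunE meval_msym; apply: meval_eq => i.
by rewrite word_point_act invgK.
Qed.

Lemma eval_words_mul a f h :
  eval_words f = eval_words h -> eval_words (a * f) = eval_words (a * h).
Proof.
by move=> E; apply/ffunP => w; have := congr1 (fun v : V => v w) E;
  rewrite !ffunE !mevalM => ->.
Qed.

(** Lagrange interpolation. *)
Lemma eval_words_surj (v : V) : exists f, eval_words f = v.
Proof.
pose L (w : word) : A :=
  \prod_i \prod_(j | j != tnth (val w) i) ('X_i - (alpha j)%:MP).
have LE w w' : (L w).@[word_point alpha (val w')] =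
    \prod_i \prod_(j | j != tnth (val w) i) (alpha (tnth (val w') i) - alpha j).
  rewrite /L rmorph_prod; apply: eq_bigr => i _ /=.
  by rewrite rmorph_prod; apply: eq_bigr => j _; rewrite /= mevalB mevalXU mevalC.
have L_neq w w' : w != w' -> (L w).@[word_point alpha (val w')] = 0.
  move=> ww'; have [i wi] : exists i, tnth (val w') i != tnth (val w) i.
    apply/existsP; apply: contraNT ww' => /existsPn ww'.
    apply/eqP/val_inj/eq_from_tnth => i; apply/eqP.
    by have := ww' i; rewrite negbK eq_sym.
  by rewrite LE (bigD1 i) //= (bigD1 (tnth (val w') i)) //= subrr !mul0r.
have L_eq w : (L w).@[word_point alpha (val w)] != 0.
  rewrite LE; apply/prodf_neq0 => i _; apply/prodf_neq0 => j ji.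
  by rewrite subr_eq0; apply: contraNneq ji => /alpha_inj ->.
exists (\sum_w (v w / (L w).@[word_point alpha (val w)]) *: L w).
apply/ffunP => w; rewrite ffunE raddf_sum (bigD1 w) //= big1 => [|w' ww'].
  by rewrite addr0 mevalZ divfK //; apply: L_eq.
by rewrite mevalZ [X in _ * X](L_neq w' w ww') mulr0.
Qed.

Lemma word_in_X (w : word) :
  in_X la alpha (\row_i word_point alpha (val w) i).
Proof.
apply/andP; split; apply/forallP => j; first by rewrite mxE; apply: codom_f.
have /forallP/(_ j) := valP w; rewrite count_tnth => /leq_trans; apply.
by apply/subset_leq_card/subsetP => i; rewrite !inE mxE => /eqP <-.
Qed.

Definition point_of_word (w : word) : X_set n la alpha :=
  exist _ (\row_i word_point alpha (val w) i) (word_in_X w).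

Lemma point_of_word_inj : injective point_of_word.
Proof.
move=> w w' /(congr1 val) /= /rowP E; apply/val_inj/eq_from_tnth => i.
by apply: alpha_inj; have := E i; rewrite !mxE.
Qed.

Lemma point_of_word_surj x : exists w, point_of_word w = x.
Proof.
case: x => p p_X; have /andP[/forallP p_cod /forallP p_ge] := p_X.
have /choice[w wE] : forall i, exists j, alpha j = p 0 i.
  by move=> i; have /codomP[j ->] := p_cod i; exists j.
have w_ge : content_ge la_ [tuple w i | i < n].
  apply/forallP => j; rewrite count_tnth; apply: leq_trans (p_ge j) _.
  apply/subset_leq_card/subsetP => i; rewrite !inE tnth_mktuple -wE.
  by rewrite (inj_eq alpha_inj).
exists (exist _ [tuple w i | i < n] w_ge); apply: val_inj; apply/rowP => i.
by rewrite /= mxE /word_point tnth_mktuple wE.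
Qed.

Lemma point_of_word_act w g :
  point_of_word (word_act w g) = X_action n la alpha (point_of_word w) g.
Proof. by apply: val_inj; apply/rowP => i; rewrite /= !mxE word_point_act. Qed.

(** The formal combination of points with given coefficients. *)
Definition freeg_of_fun (v : V) : {freeg (X_set n la alpha) / rat} :=
  \sum_w v w *: << point_of_word w >>.

Lemma freeg_of_fun_linear : linear freeg_of_fun.
Proof.
move=> a u v; rewrite /freeg_of_fun scaler_sumr -big_split.
by apply: eq_bigr => w _; rewrite !ffunE scalerDl scalerA.
Qed.

HB.instance Definition _ :=
  GRing.isLinear.Build rat V _ _ freeg_of_fun freeg_of_fun_linear.

Lemma coeff_freeg_of_fun v w : coeff (point_of_word w) (freeg_of_fun v) = v w.
Proof.
rewrite /freeg_of_fun raddf_sum (bigD1 w) //= big1 => [|w' /negPf ww'].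
  by rewrite coeffZ coeffU eqxx !mulr1 addr0.
by rewrite coeffZ coeffU (inj_eq point_of_word_inj) ww' !mulr0.
Qed.

Lemma freeg_of_fun_inj : injective freeg_of_fun.
Proof.
by move=> u v E; apply/ffunP => w; rewrite -!coeff_freeg_of_fun E.
Qed.

Lemma freeg_of_fun_surj D : exists v, freeg_of_fun v = D.
Proof.
exists [ffun w => coeff (point_of_word w) D]; apply/eqP/freeg_eqP => x.
by have [w <-] := point_of_word_surj x; rewrite coeff_freeg_of_fun ffunE.
Qed.

Lemma freeg_of_fun_act v g :
  freeg_of_fun (fun_module v g) = QX_module n la alpha (freeg_of_fun v) g.
Proof.
apply/eqP/freeg_eqP => x; have [w <-] := point_of_word_surj x.
rewrite /= perm_module_act_coeff -/(X_action n la alpha) -point_of_word_act.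
by rewrite !coeff_freeg_of_fun ffunE.
Qed.

End PointsModule.

(** * The isomorphism *)

Section Comparison.
Context (n s : nat) (la : seq nat).
Hypotheses (la_sum : sumn la <= n) (la_size : size la <= s).
Local Notation la_ := (fun j : 'I_s => nth 0 la j).

Lemma conj_tail_nth m : m <= n ->
  conj_tail n la m = \sum_(j < s) (nth 0 la j - (n - m)).
Proof.
move=> le_mn; rewrite sum_nth_subn // conj_tailE // => x xla.
by apply: leq_trans la_sum; rewrite sumnE (big_rem x) //= leq_addr.
Qed.

(** The generators of degree [d = 0] that distinguish the restricted ideal do not
    occur when the partition has size at most [n]. *)
Lemma restricted_ideal_sub f :
  f \in ideal_gen (restricted_gens setT la_) -> f \in I_ideal n la s.
Proof.
apply: ideal_gen_sub => [|x y|a g Gg]; [exact: rpred0 | exact: rpredD |].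
apply: ideal_genM; case: Gg => [i|i|S d _ lt_d].
- by rewrite inE.
- by apply/mem_ideal_gen/I_gens_pow.
have le_S : #|S| <= n by rewrite -[X in _ <= X]card_ord max_card.
rewrite cardsT card_ord -conj_tail_nth // in lt_d.
apply: mem_ideal_gen; apply: I_gens_elem_sym => //.
case: d lt_d => // lt_S; suff: conj_tail n la #|S| <= #|S| by lia.
rewrite conj_tail_nth // sum_nth_subn // (leq_trans (sum_subn_le _ _)) //; lia.
Qed.

Lemma graded_map_I_ideal (alpha : 'I_s -> rat)
    (phi : {linear {mpoly rat[n]} -> {ffun word n s la -> rat^o}}) :
    (forall d f h, f \is d.-homog -> msize h <= d ->
       eval_words la alpha f = eval_words la alpha h -> phi f = 0%R) ->
  forall f, f \in I_ideal n la s -> phi f = 0%R.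
Proof.
move=> phi_lower f If.
have phi_mul := graded_map_mul_lower (@eval_words_mul n s la alpha) phi_lower.
have ev_eq (g h : {mpoly rat[n]}) :
  (forall w, content_ge la_ w ->
     g.@[word_point alpha w] = h.@[word_point alpha w])%R ->
  eval_words la alpha g = eval_words la alpha h.
  by move=> gh; apply/ffunP => w; rewrite !ffunE gh //; apply: valP.
pose B := [pred f | phi f == 0%R]; apply/eqP; rewrite -[_ == _]/(f \in B).
apply: ideal_gen_sub If => [|x y|a _ [i|S d _ lt_d]].
- by rewrite inE linear0.
- by rewrite !inE => /eqP x0 /eqP y0; rewrite linearD x0 y0 addr0.
- have [h le_h hE] := powX_lower alpha i; rewrite inE; apply/eqP.
  by apply: phi_mul (powX_dhomog i s) le_h _; apply: ev_eq.
have le_S : #|S| <= n by rewrite -[X in _ <= X]card_ord max_card.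
rewrite conj_tail_nth // in lt_d; have [h le_h hE] := elem_sym_lower alpha lt_d.
rewrite inE; apply/eqP.
by apply: phi_mul (elem_sym_dhomog S d) le_h _; apply: ev_eq.
Qed.

End Comparison.

Theorem corollary3p2 (n k s : nat) (la : seq nat) (alpha : 'I_s -> rat)
    (k_gt0 : 0 < k) (le_kn : k <= n) (s_gt0 : 0 < s)
    (la_part : is_partition k la) (la_size : size la <= s)
    (alpha_inj : injective alpha) :
  module_iso (R_module n la s) (QX_module n la alpha).
Proof.
have la_sum : sumn la <= n by have /and3P[_ _ /eqP ->] := la_part.
have [phi [phi_act phi_surj phi_lower]] :=
  exists_graded_map (@eval_words_act n s la alpha) (eval_words_surj alpha_inj).
have phi_I := graded_map_I_ideal la_sum la_size phi_lower.
have phi_ker f : phi f = 0%R -> f \in I_ideal n la s.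
  have [b bP] := words_span_quotient (fun j : 'I_s => nth 0 la j)
    (etrans (cardsT _) (card_ord n)).
  pose bW (w : word n s la) := b (val w).
  apply: (spanned_kernel (b := bW) phi_surj phi_I) => {}f.
  have [c /(restricted_ideal_sub la_sum la_size) Kc] := bP f.
  by exists (fun w => c (val w)); rewrite -(big_word la (fun w => c w *: b w)%R).
pose psi f := freeg_of_fun alpha (phi f).
have psi_lin : linear psi by move=> a f h; rewrite /psi !linearP.
pose L : {linear _ -> _} := HB.pack psi
  (GRing.isLinear.Build rat {mpoly rat[n]} {freeg (X_set n la alpha) / rat}
     _ psi psi_lin).
apply: (@quot_module_iso _ _ _ _ _ _ _ _ L) => [f g|f|D] /=.
- by rewrite /psi phi_act freeg_of_fun_act.
- split=> [|/phi_I f0]; last by rewrite /psi f0 linear0.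
  rewrite /psi -[0%R](linear0 (@freeg_of_fun n s la alpha)).
  by move/(freeg_of_fun_inj alpha_inj)/phi_ker.
have [v <-] := freeg_of_fun_surj alpha_inj D; have [f <-] := phi_surj v.
by exists f.
Qed.
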